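(* If a permutation $w \in S_n$ is skew-merged, then the number of complete non-attacking rook placements on $\operatorname{Grid}(w)$ is either one or two.
   Context: For a permutation $w \in S_n$, $\operatorname{Grid}(w)$ is the $n\times n$ array of squares in which the squares in (row, column) positions $(i, w(i))$, $i = 1,\dots,n$, are black and all other squares are white. An across word is a maximal (non-empty) contiguous sequence of white squares within a single row; a down word is a maximal (non-empty) contiguous sequence of white squares within a single column. A complete non-attacking rook placement on a grid is a subset of its white squares containing exactly one square of every across word and exactly one square of every down word. A permutation $w$ is skew-merged if the entries of its one-line notation $w(1)\cdots w(n)$ can be partitioned into an increasing subsequence and a decreasing subsequence (either of which may be empty). *)

(* Defs.v *)
From mathcomp Require Import all_boot all_order all_fingroup.

Set Implicit Arguments.
Unset Strict Implicit.
Unset Printing Implicit Defensive.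

(* A square is a pair (row, column), both counted from 0. *)
Notation square n := ('I_n * 'I_n)%type.

Section Grid.

Variables (n : nat) (w : 'S_n).

Definition white : {set square n} := [set s : square n | s.2 != w s.1].

(* Words are sets of squares: nonempty runs of white squares that are maximal
   for inclusion among the runs of the same direction. *)
Definition row_run (A : {set square n}) : bool :=
  [exists i : 'I_n, exists a : 'I_n, exists b : 'I_n,
    (a <= b) && (A == [set s : square n | (s.1 == i) && (a <= s.2 <= b)])].

Definition column_run (A : {set square n}) : bool :=
  [exists j : 'I_n, exists a : 'I_n, exists b : 'I_n,
    (a <= b) && (A == [set s : square n | (s.2 == j) && (a <= s.1 <= b)])].

Definition across_word (A : {set square n}) : bool :=
  maxset (fun B => row_run B && (B \subset white)) A.

Definition down_word (A : {set square n}) : bool :=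
  maxset (fun B => column_run B && (B \subset white)) A.

Definition complete_rook_placement (R : {set square n}) : bool :=
  [&& R \subset white,
      [forall A, across_word A ==> (#|R :&: A| == 1)] &
      [forall A, down_word A ==> (#|R :&: A| == 1)]].

(* A is the set of positions of the increasing subsequence. *)
Definition skew_merged : Prop :=
  exists A : {set 'I_n},
    {in A &, forall i j : 'I_n, i < j -> w i < w j} /\
    {in ~: A &, forall i j : 'I_n, i < j -> w j < w i}.

End Grid.

(* Main.v *)
Require Import Defs.
From mathcomp Require Import all_boot all_order all_fingroup all_algebra.

Set Implicit Arguments.
Unset Strict Implicit.
Unset Printing Implicit Defensive.

Import Order.TTheory GRing.Theory Num.Theory.

(* Write a point for each black square and let (x, y) be the square in the row of
   point x and the column of point y; placements then make sense for any finite
   set of points, so that points can be deleted without re-indexing. Whenever a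
   corner of the bounding box is black, deleting it does not change the number of
   placements. Otherwise a skew-merged set is a pinwheel: its topmost and
   bottommost points are increasing, and its leftmost and rightmost points are
   decreasing (or conversely). From the leftmost point x downwards the points are
   increasing, which forces a rook on (v, u) whenever v is the next point below u;
   if the neighbours p above and s below x satisfy col p < col s, then (x, p) is
   forced too, and deleting x while moving the rook (x, p) to (s, p) is a
   bijection. If this fails on each of the four sides, then the set is a copy of
   2413, which has two placements. One ends with 2413 or with at most one point,
   where the placement is unique. *)

Local Open Scope ring_scope.

(** * Counting by inverse maps, and sets met exactly once *)

Lemma card_eq_cancel_in (U V : finType) (P : {set U}) (Q : {set V})
    (h : U -> V) (k : V -> U) :
    {in P, forall u, h u \in Q /\ k (h u) = u} ->
    {in Q, forall v, k v \in P /\ h (k v) = v} ->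
  #|P| = #|Q|.
Proof.
move=> hP kQ; apply/eqP; rewrite eqn_leq; apply/andP; split.
- rewrite -(card_in_imset (f := h)); last first.
    by move=> u v /hP[_ {2}<-] /hP[_ {2}<-] ->.
  by apply/subset_leq_card/subsetP => _ /imsetP[u /hP[? _] ->].
- rewrite -(card_in_imset (f := k)); last first.
    by move=> u v /kQ[_ {2}<-] /kQ[_ {2}<-] ->.
  by apply/subset_leq_card/subsetP => _ /imsetP[u /kQ[? _] ->].
Qed.

Section Hit.

Variable T : finType.
Implicit Types (W S : {set T}) (x y z : T).

Definition hit W S := (W == set0) || (#|W :&: S| == 1%N).

Lemma hit_ex W S y : hit W S -> y \in W -> exists2 z, z \in W & z \in S.
Proof.
case/orP=> [/eqP-> | /cards1P[z E] _]; first by rewrite inE.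
by move/setP/(_ z): E; rewrite !inE eqxx => /andP[]; exists z.
Qed.

Lemma hit_uniq W S y z :
  hit W S -> y \in W -> y \in S -> z \in W -> z \in S -> y = z.
Proof.
case/orP=> [/eqP-> | /cards1P[t E] yW yS zW zS]; first by rewrite inE.
move/setP: E => E; move: (E y) (E z); rewrite !inE yW yS zW zS.
by move=> /esym/eqP-> /esym/eqP->.
Qed.

Lemma hit_intro W S y :
  y \in W -> y \in S -> (forall z, z \in W -> z \in S -> z = y) -> hit W S.
Proof.
move=> yW yS u; apply/orP; right; apply/cards1P; exists y.
apply/setP=> z; rewrite !inE; apply/andP/eqP=> [[/u H /H]//|->//].
Qed.

Lemma hit_transfer W S W' S' :
  (forall y, y \in W' -> exists z, z \in W) -> W :&: S = W' :&: S' ->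
  hit W S -> hit W' S'.
Proof.
move=> ne E; rewrite /hit E => /orP[/eqP W0|->]; last by rewrite orbT.
apply/orP; left; apply/eqP/setP=> y; rewrite inE; apply/negP=> /ne[z].
by rewrite W0 inE.
Qed.

End Hit.

(** * Placements on a finite set of points, and their symmetries *)

Section Placement.

Variable T : finType.
Implicit Types (f g h : T -> int) (A B : {set T}) (R : {set T * T}) (x y z : T).

Definition opp h x := - h x.

(** With [h] equal to [f], [opp f], [g] or [opp g] this is the run above, below, left or right of
    the black square of [x], its squares being named by the coordinate that varies. One notion thus
    serves all four directions. *)
Definition before h A x := [set y in A | h y < h x].

Definition row R x := [set y | (x, y) \in R].
Definition col R y := [set x | (x, y) \in R].

(* The points of [A] stand for the black squares, [f] and [g] giving their rows
   and columns; the pair [(x, y)] stands for the square in the row of [x] and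
   the column of [y]. *)
Definition placement f g A R :=
  [forall s in R, [&& s.1 \in A, s.2 \in A & s.1 != s.2]] &&
  [forall x in A,
    [&& hit (before g A x) (row R x), hit (before (opp g) A x) (row R x),
        hit (before f A x) (col R x) & hit (before (opp f) A x) (col R x)]].

Definition placements f g A := [set R | placement f g A R].

Lemma placementP f g A R :
  reflect
   [/\ forall x y, (x, y) \in R -> [/\ x \in A, y \in A & x != y],
       {in A, forall x, hit (before g A x) (row R x)},
       {in A, forall x, hit (before (opp g) A x) (row R x)},
       {in A, forall x, hit (before f A x) (col R x)} &
       {in A, forall x, hit (before (opp f) A x) (col R x)}]
   (placement f g A R).
Proof.
apply: (iffP andP) => [[/forall_inP sub /forall_inP H]|[sub H1 H2 H3 H4]].
  by split=> [x y /sub/and3P//|x xA|x xA|x xA|x xA]; case/and4P: (H x xA).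
split; apply/forall_inP; first by move=> [x y] /sub[? ? ?]; apply/and3P.
by move=> x xA; rewrite H1 ?H2 ?H3 ?H4.
Qed.

Lemma in_before h A x y : (y \in before h A x) = (y \in A) && (h y < h x).
Proof. by rewrite inE. Qed.

Lemma in_row R x y : (y \in row R x) = ((x, y) \in R).
Proof. by rewrite inE. Qed.

Lemma in_col R x y : (x \in col R y) = ((x, y) \in R).
Proof. by rewrite inE. Qed.

Lemma before_oppK h A x : before (opp (opp h)) A x = before h A x.
Proof. by apply/setP=> y; rewrite !inE /opp !opprK. Qed.

Lemma placement_opp_row f g A R : placement (opp f) g A R = placement f g A R.
Proof.
rewrite /placement; congr (_ && _); apply: eq_forallb => x.
rewrite before_oppK; congr (_ ==> _).
by rewrite [X in [&& _, _ & X]]andbC.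
Qed.

Lemma card_placements_opp_row f g A :
  #|placements (opp f) g A| = #|placements f g A|.
Proof. by congr #|pred_of_set _|; apply/setP=> R; rewrite !inE placement_opp_row. Qed.

Definition tr R := [set s | (s.2, s.1) \in R].

Lemma trK : involutive tr.
Proof. by move=> R; apply/setP=> -[x y]; rewrite !inE. Qed.

Lemma placement_tr f g A R : placement f g A R -> placement g f A (tr R).
Proof.
have rowE S x : row (tr S) x = col S x by apply/setP=> y; rewrite !inE.
have colE S x : col (tr S) x = row S x by apply/setP=> y; rewrite !inE.
case/placementP=> sub H1 H2 H3 H4; apply/placementP.
split=> [x y|x|x|x|x]; rewrite ?rowE ?colE; auto.
by rewrite inE /= => /sub[? ? ?]; rewrite eq_sym.
Qed.

Lemma card_placements_swap f g A : #|placements g f A| = #|placements f g A|.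
Proof.
by apply: (card_eq_cancel_in (h := tr) (k := tr)) => R;
  rewrite !inE => /placement_tr; rewrite trK.
Qed.

(** A quarter turn is a transposition followed by a reflection. It lets an argument about the
    leftmost point serve all four sides. *)
Lemma card_placements_rot f g A :
  #|placements (opp g) f A| = #|placements f g A|.
Proof. by rewrite card_placements_opp_row card_placements_swap. Qed.

Lemma exists_min h A x :
  x \in A -> exists2 m, m \in A & {in A, forall z, h m <= h z}.
Proof. by move=> xA; case: (arg_minP h xA) => m; exists m. Qed.

Lemma exists_max h A x :
  x \in A -> exists2 m, m \in A & {in A, forall z, h z <= h m}.
Proof. by move=> xA; case: (arg_maxP h xA) => m; exists m. Qed.

Lemma placements0 f g : #|placements f g set0| = 1%N.
Proof.
apply/eqP/cards1P; exists set0; apply/setP=> R; rewrite !inE.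
apply/placementP/eqP=> [[sub _ _ _ _]|->].
  by apply/setP=> -[x y]; rewrite !inE; apply/negP=> /sub[]; rewrite inE.
by split=> [x y|x|x|x|x]; rewrite inE.
Qed.

Lemma placements1 f g x : #|placements f g [set x]| = 1%N.
Proof.
have b0 h : before h [set x] x = set0.
  by apply/setP=> z; rewrite !inE; case: eqP => //= ->; rewrite ltxx.
apply/eqP/cards1P; exists set0; apply/setP=> R; rewrite !inE.
apply/placementP/eqP=> [[sub _ _ _ _]|->].
  apply/setP=> -[y z]; rewrite !inE; apply/negP=> /sub[].
  by rewrite !inE => /eqP-> /eqP->; rewrite eqxx.
split=> [y z|z /set1P->|z /set1P->|z /set1P->|z /set1P->];
  first by rewrite in_set0.
all: by rewrite /hit b0 eqxx.
Qed.

End Placement.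

(** * Deleting a black corner, and rooks forced by an increasing sequence *)

Section Deletion.

Variable T : finType.
Implicit Types (f g h : T -> int) (A B : {set T}) (R : {set T * T}) (x y z : T).

Lemma inj_lt h x y : injective h -> y != x -> h x <= h y -> h x < h y.
Proof. by move=> ih; rewrite lt_neqAle (inj_eq ih) eq_sym => ->. Qed.

Lemma opp_inj h : injective h -> injective (opp h).
Proof. by move=> ih x y /oppr_inj/ih. Qed.

Lemma lt_opp h x y : (opp h x < opp h y) = (h y < h x).
Proof. exact: ltrN2. Qed.

Lemma hit_before_empty h A z S : {in A, forall y, h z <= h y} -> hit (before h A z) S.
Proof.
move=> H; apply/orP; left; apply/eqP/setP=> y; rewrite !inE; apply/negP=> /andP[/H].
by rewrite leNgt => /negP.
Qed.

(** The run at [z] keeps its rook because that rook is not lost with [x]. The sets [S] and [S'] are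
    compared inside the run only, so that rooks may be moved elsewhere. *)
Lemma hit_before_del h A x z (S S' : {set T}) :
  {in A :\ x, forall y, h y < h z -> (y \in S) = (y \in S')} ->
  (h x < h z -> x \notin S) ->
  hit (before h A z) S -> hit (before h (A :\ x) z) S'.
Proof.
move=> E xS; apply: hit_transfer => [y|].
  by rewrite !inE => /andP[/andP[_ yA] yz]; exists y; rewrite !inE yA.
apply/setP=> y; move: (E y); rewrite !inE.
have [->|_] := eqVneq y x; last first.
  by case: (y \in A) => //=; case: (h y < h z) => //= ->.
by case: (x \in A) => //=; case: (h x < h z) xS => //= /(_ isT)/negbTE.
Qed.

(** A run consisting of [x] alone would be new and would inherit no rook. Hence the extra clause: a
    run that receives [x] must already contain another point. *)
Lemma hit_before_add h A x z (S S' : {set T}) :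
  {in A :\ x, forall y, h y < h z -> (y \in S) = (y \in S')} ->
  (h x < h z -> x \notin S /\ exists2 y, y \in A :\ x & h y < h z) ->
  hit (before h (A :\ x) z) S' -> hit (before h A z) S.
Proof.
move=> E xS; apply: hit_transfer => [y|].
  rewrite !inE => /andP[yA yz]; have [yx|nyx] := eqVneq y x.
    by case: xS => [|_ [u uA uz]]; [rewrite -yx | exists u; rewrite inE uA].
  by exists y; rewrite !inE nyx yA.
apply/setP=> y; move: (E y); rewrite !inE.
have [->|_] := eqVneq y x; last first.
  by case: (y \in A) => //=; case: (h y < h z) => //= ->.
by case: (x \in A) => //=; case: (h x < h z) xS => //= /(_ isT)[/negbTE].
Qed.

(** Let [y1] be the second point from the top. Above it in its column there is only the row of [x],
    so a rook on (x, y1) is forced, and it is alone in the row of [x], which has a single run. In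
    the same way (y2, x) is the only rook in the column of [x], where [y2] is second from the left.
    Deletion therefore removes exactly two forced rooks. *)
Lemma card_placements_corner f g A x :
    injective f -> injective g -> x \in A ->
    {in A, forall z, f x <= f z} -> {in A, forall z, g x <= g z} ->
    A :\ x != set0 ->
  #|placements f g A| = #|placements f g (A :\ x)|.
Proof.
move=> fi gi xA xf xg /set0Pn[u uA'].
have [y1 y1A' y1f] := exists_min f uA'.
have [y2 y2A' y2g] := exists_min g uA'.
have A'E z : (z \in A :\ x) = (z != x) && (z \in A) by rewrite !inE.
have A'x z : z \in A :\ x -> [/\ z \in A, z != x, f x < f z & g x < g z].
  rewrite A'E => /andP[zx zA].
  by split; rewrite ?(inj_lt fi zx (xf _ zA)) ?(inj_lt gi zx (xg _ zA)).
have [y1A y1x xy1f xy1g] := A'x _ y1A'.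
have [y2A y2x xy2f xy2g] := A'x _ y2A'.
have f1 z : z \in A -> f z < f y1 -> z = x.
  move=> zA zy; apply/eqP; apply: contraTT zy => zx.
  by rewrite -leNgt; apply: y1f; rewrite A'E zx.
have g2 z : z \in A -> g z < g y2 -> z = x.
  move=> zA zy; apply/eqP; apply: contraTT zy => zx.
  by rewrite -leNgt; apply: y2g; rewrite A'E zx.
have xW1 : x \in before f A y1 by rewrite in_before xA.
have xW2 : x \in before g A y2 by rewrite in_before xA.
pose A' := A :\ x.
pose psi R := R :&: setX A' A'.
pose phi R := (x, y1) |: ((y2, x) |: R).
have psiE R a b : (a, b) \in psi R = [&& (a, b) \in R, a \in A' & b \in A'].
  by rewrite in_setI in_setX.
have phiE R a b : (a, b) \in phi R =
   [|| (a == x) && (b == y1), (a == y2) && (b == x) | (a, b) \in R].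
  by rewrite in_setU1 in_setU1.
apply: (card_eq_cancel_in (h := psi) (k := phi)) => R;
  rewrite !inE => /placementP[sub H1 H2 H3 H4].
- have xR z : (x, z) \in R -> z = y1.
    move=> xz; have [_ zA xnz] := sub _ _ xz.
    have [z'] := hit_ex (H3 _ y1A) xW1.
    rewrite in_before => /andP[z'A z'f]; rewrite in_col (f1 z') // => xy1.
    apply: (hit_uniq (H2 _ xA)); rewrite ?in_row // in_before ?zA ?y1A lt_opp //.
    by have /A'x[] : z \in A :\ x by rewrite A'E eq_sym xnz.
  have Rx z : (z, x) \in R -> z = y2.
    move=> zx; have [zA _ znx] := sub _ _ zx.
    have [z'] := hit_ex (H1 _ y2A) xW2.
    rewrite in_before => /andP[z'A z'g]; rewrite in_row (g2 z') // => y2x'.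
    apply: (hit_uniq (H4 _ xA)); rewrite ?in_col // in_before ?zA ?y2A lt_opp //.
    by have /A'x[] : z \in A :\ x by rewrite A'E znx.
  have xy1R : (x, y1) \in R.
    have [z zW zR] := hit_ex (H3 _ y1A) xW1.
    by move: zW zR; rewrite in_before in_col => /andP[zA /(f1 _ zA) ->].
  have y2xR : (y2, x) \in R.
    have [z zW zR] := hit_ex (H1 _ y2A) xW2.
    by move: zW zR; rewrite in_before in_row => /andP[zA /(g2 _ zA) ->].
  split.
    apply/placementP; split.
    + by move=> a b; rewrite psiE => /and3P[/sub[]].
    + move=> z zA'; have [zA zx _ _] := A'x _ zA'.
      (* Once [x] is gone [y2] is leftmost, so losing the rook (y2, x) leaves no run unserved. *)
      have [->|zy2] := eqVneq z y2; first exact: hit_before_empty.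
      apply: hit_before_del (H1 _ zA) => [y yA' _|_]; rewrite !in_row.
        by rewrite psiE zA' yA' !andbT.
      by apply: contraNN zy2 => /Rx->.
    + move=> z zA'; have [zA zx _ xz] := A'x _ zA'.
      apply: hit_before_del (H2 _ zA) => [y yA' _|]; last first.
        by rewrite lt_opp ltNge (ltW xz).
      by rewrite !in_row psiE zA' yA' !andbT.
    + move=> z zA'; have [zA zx _ _] := A'x _ zA'.
      have [->|zy1] := eqVneq z y1; first exact: hit_before_empty.
      apply: hit_before_del (H3 _ zA) => [y yA' _|_]; rewrite !in_col.
        by rewrite psiE zA' yA' !andbT.
      by apply: contraNN zy1 => /xR->.
    + move=> z zA'; have [zA zx xz _] := A'x _ zA'.
      apply: hit_before_del (H4 _ zA) => [y yA' _|]; last first.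
        by rewrite lt_opp ltNge (ltW xz).
      by rewrite !in_col psiE zA' yA' !andbT.
  apply/setP=> -[a b]; rewrite phiE psiE; apply/or3P/idP=> [|abR].
    by case=> [/andP[/eqP-> /eqP->]|/andP[/eqP-> /eqP->]|/and3P[]].
  have [aA bA ab] := sub _ _ abR.
  have [ax|ax] := eqVneq a x.
    by constructor 1; rewrite ax in abR; rewrite (xR _ abR) !eqxx.
  have [bx|bx] := eqVneq b x.
    by constructor 2; rewrite bx in abR; rewrite (Rx _ abR) !eqxx.
  by constructor 3; rewrite abR !A'E ax bx aA bA.
- have Rx' z : ((x, z) \in R = false) * ((z, x) \in R = false).
    by split; apply/negP=> /sub[]; rewrite !A'E eqxx.
  split.
    apply/placementP; split.
    + move=> a b; rewrite phiE => /or3P[/andP[/eqP-> /eqP->]|/andP[/eqP-> /eqP->]|/sub[]].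
      * by rewrite eq_sym.
      * by [].
      * by rewrite !A'E => /andP[_ ->] /andP[_ ->].
    + move=> z zA; have [->|zx] := eqVneq z x; first exact: hit_before_empty.
      have zA' : z \in A :\ x by rewrite A'E zx.
      have [_ _ _ xz] := A'x _ zA'.
      have [->|zy2] := eqVneq z y2.
        apply: (@hit_intro _ _ _ x).
        * by rewrite in_before xA.
        * by rewrite in_row phiE !eqxx orbT.
        * by move=> t; rewrite in_before => /andP[tA /(g2 _ tA)].
      apply: hit_before_add (H1 _ zA') => [y|_].
        by rewrite !in_row phiE A'E (negbTE zx) (negbTE zy2).
      split; last first.
        by exists y2; last exact: inj_lt (y2g _ zA').
      by rewrite in_row phiE (negbTE zx) (negbTE zy2) Rx'.
    + move=> z zA; have [->|zx] := eqVneq z x.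
        apply: (@hit_intro _ _ _ y1).
        * by rewrite in_before y1A lt_opp.
        * by rewrite in_row phiE !eqxx.
        * move=> t; rewrite in_before in_row phiE eqxx /= Rx' orbF => /andP[tA tx].
          by case/orP=> [/eqP//|/andP[_ /eqP tx']]; move: tx; rewrite tx' ltxx.
      have zA' : z \in A :\ x by rewrite A'E zx.
      have [_ _ _ xz] := A'x _ zA'.
      apply: hit_before_add (H2 _ zA') => [y|]; last by rewrite lt_opp ltNge (ltW xz).
      by rewrite A'E !in_row phiE => /andP[/negbTE-> _]; rewrite (negbTE zx) !andbF.
    + move=> z zA; have [->|zx] := eqVneq z x; first exact: hit_before_empty.
      have zA' : z \in A :\ x by rewrite A'E zx.
      have [_ _ xz _] := A'x _ zA'.
      have [->|zy1] := eqVneq z y1.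
        apply: (@hit_intro _ _ _ x).
        * by rewrite in_before xA.
        * by rewrite in_col phiE !eqxx.
        * by move=> t; rewrite in_before => /andP[tA /(f1 _ tA)].
      apply: hit_before_add (H3 _ zA') => [y|_].
        by rewrite !in_col phiE A'E (negbTE zx) (negbTE zy1) !andbF.
      split; last first.
        by exists y1; last exact: inj_lt (y1f _ zA').
      by rewrite in_col phiE (negbTE zx) (negbTE zy1) Rx' !andbF.
    + move=> z zA; have [->|zx] := eqVneq z x.
        apply: (@hit_intro _ _ _ y2).
        * by rewrite in_before y2A lt_opp.
        * by rewrite in_col phiE !eqxx orbT.
        * move=> t; rewrite in_before in_col phiE eqxx /= Rx' orbF => /andP[tA tx].
          case/orP=> [/andP[/eqP tx' _]|/andP[/eqP->]//].
          by move: tx; rewrite tx' ltxx.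
      have zA' : z \in A :\ x by rewrite A'E zx.
      have [_ _ xz _] := A'x _ zA'.
      apply: hit_before_add (H4 _ zA') => [y|]; last by rewrite lt_opp ltNge (ltW xz).
      by rewrite A'E !in_col phiE => /andP[/negbTE-> _]; rewrite (negbTE zx) !andbF.
  apply/setP=> -[a b]; rewrite psiE phiE !A'E.
  have [->|ax] := eqVneq a x; first by rewrite andbF Rx'.
  have [->|bx] := eqVneq b x; first by rewrite !andbF Rx'.
  rewrite andbF /=; apply/andP/idP=> [[]//|abR]; split=> //.
  by have [] := sub _ _ abR; rewrite !A'E ax bx => /= -> ->.
Qed.

(* The column of [u] needs a rook below its black square; below the next row it
   would share an across word with the rook provided by induction. *)
Lemma increasing_rook f g A R u v :
    injective f -> placement f g A R -> u \in A -> v \in A -> f u < f v ->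
    {in A, forall z, f u < f z -> f v <= f z} ->
    {in A &, forall y z, f u <= f y -> f y < f z -> g y < g z} ->
  (v, u) \in R.
Proof.
move=> fi /placementP[sub H1 H2 H3 H4].
have [m] := ubnP #|[set z in A | f u < f z]|.
elim: m => // m IH in u v * => cm uA vA uv uv' incr.
have [k] : exists2 k, k \in before (opp f) A u & k \in col R u.
  by apply: (hit_ex (H4 _ uA) (y := v)); rewrite in_before vA lt_opp.
rewrite in_before in_col lt_opp => /andP[kA uk] kuR.
have [kv|nkv] := eqVneq k v; first by rewrite -kv.
have vk : f v < f k := inj_lt fi nkv (uv' _ kA uk).
have vB : v \in before f A k by rewrite in_before vA.
(* [k'] is the point just above [k]. It lies below [u], so the induction on the number of lower
   points applies to it and puts a rook on (k, k'). *)
have [k' k'B k'max] := exists_max f vB.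
move: (k'B); rewrite in_before => /andP[k'A k'k].
have vk' := k'max _ vB; have uk' := lt_le_trans uv vk'.
have k'R : (k, k') \in R.
  apply: IH => //.
  - move: cm; rewrite ltnS; apply: leq_trans; apply: proper_card; apply/properP; split.
      by apply/subsetP=> z; rewrite !inE => /andP[-> /(lt_trans uk')].
    by exists v; rewrite !inE vA //= -leNgt.
  - move=> z zA k'z; rewrite leNgt; apply/negP=> zk.
    by have := k'max z; rewrite in_before zA zk leNgt k'z => /(_ isT).
  - by move=> y z yA zA /(le_trans (ltW uk')); apply: incr.
suff E : u = k' by rewrite E ltxx in uk'.
by apply: (hit_uniq (H1 _ kA)); rewrite ?in_row // in_before ?uA ?k'A;
  apply: incr => //; exact: ltW.
Qed.

End Deletion.

(** * Deleting the leftmost point *)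

Section SideDeletion.

(** Here [x] is leftmost, [s] and [p] are its successor and predecessor in row order, and [l] is
    second from the left; [l] and [p] may coincide. *)
Variables (T : finType) (f g : T -> int) (A : {set T}) (x s p l : T).
Hypotheses (fi : injective f) (gi : injective g).
Hypotheses (xA : x \in A) (sA : s \in A) (pA : p \in A) (lA : l \in A).
Hypothesis xg : {in A, forall z, g x <= g z}.
Hypotheses (fxs : f x < f s) (sx : {in A, forall z, f x < f z -> f s <= f z}).
Hypotheses (fpx : f p < f x) (px : {in A, forall z, f z < f x -> f z <= f p}).
Hypothesis incr :
  {in A &, forall y z, f x <= f y -> f y < f z -> g y < g z}.
Hypothesis gps : g p < g s.
Hypotheses (lx : l != x) (lg : {in A, forall z, z != x -> g l <= g z}).
Hypothesis flx : f l < f x.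

Let A' := A :\ x.

Let A'E z : (z \in A') = (z != x) && (z \in A).
Proof. by rewrite !inE. Qed.

Let A'x z : z \in A' -> [/\ z \in A, z != x & g x < g z].
Proof. by rewrite A'E => /andP[zx zA]; rewrite zA zx (inj_lt gi zx) ?xg. Qed.

Let neq_lt (h : T -> int) y z : h y < h z -> y != z.
Proof. by apply: contraTneq => ->; rewrite ltxx. Qed.

Let sx' : s != x. Proof. by rewrite eq_sym; apply: neq_lt fxs. Qed.
Let px' : p != x. Proof. exact: neq_lt fpx. Qed.
Let ps : p != s. Proof. exact: neq_lt gps. Qed.
Let fps : f p < f s. Proof. exact: lt_trans fxs. Qed.
Let ls : l != s. Proof. exact: neq_lt (lt_trans flx fxs). Qed.

Let sA' : s \in A'. Proof. by rewrite A'E sx'. Qed.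
Let pA' : p \in A'. Proof. by rewrite A'E px'. Qed.
Let lA' : l \in A'. Proof. by rewrite A'E lx. Qed.

Let g_l z : z \in A -> g z < g l -> z = x.
Proof.
move=> zA zl; apply/eqP; apply: contraTT zl => zx.
by rewrite -leNgt; apply: lg.
Qed.

Let g_s z : z \in A -> f s <= f z -> g s <= g z.
Proof.
move=> zA sz; have [->//|zs] := eqVneq z s.
by apply/ltW/incr; rewrite ?ltW // (inj_lt fi zs).
Qed.

(** The rooks in the row and column of [x] turn out to be (x, p), (s, x) and (l, x). Removing them
    takes the rook from the run left of [s] and from the run below [p]; the single new rook (s, p)
    serves both. *)
Let psi (R : {set T * T}) := (s, p) |: (R :&: setX A' A').
Let phi (R : {set T * T}) := (x, p) |: ((s, x) |: ((l, x) |: (R :\ (s, p)))).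

Let psiE R a b : ((a, b) \in psi R) =
  ((a == s) && (b == p)) || [&& (a, b) \in R, a \in A' & b \in A'].
Proof. by rewrite in_setU1 in_setI in_setX. Qed.

Let phiE R a b : ((a, b) \in phi R) =
  [|| (a == x) && (b == p), (a == s) && (b == x), (a == l) && (b == x) |
      ~~ ((a == s) && (b == p)) && ((a, b) \in R)].
Proof. by rewrite !in_setU1 in_setD1. Qed.

Section Forward.

Variable R : {set T * T}.
Hypothesis pl : placement f g A R.

Let sub a b : (a, b) \in R -> [/\ a \in A, b \in A & a != b].
Proof. by case/placementP: pl => + _ _ _ _; apply. Qed.
Let H1 : {in A, forall z, hit (before g A z) (row R z)}.
Proof. by case/placementP: pl. Qed.
Let H2 : {in A, forall z, hit (before (opp g) A z) (row R z)}.
Proof. by case/placementP: pl. Qed.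
Let H3 : {in A, forall z, hit (before f A z) (col R z)}.
Proof. by case/placementP: pl. Qed.
Let H4 : {in A, forall z, hit (before (opp f) A z) (col R z)}.
Proof. by case/placementP: pl. Qed.

Let sxR : (s, x) \in R.
Proof. exact: increasing_rook fi pl xA sA fxs sx incr. Qed.

Let lxR : (l, x) \in R.
Proof.
have xW : x \in before g A l by rewrite in_before xA; case: (A'x lA').
have [z zW zR] := hit_ex (H1 lA) xW.
by move: zW zR; rewrite in_before in_row => /andP[zA /(g_l zA)->].
Qed.

Let gxs : g x < g s. Proof. by case: (A'x sA'). Qed.

Let s_left z : z \in A -> g z < g s -> (s, z) \in R -> z = x.
Proof.
move=> zA zs sz.
by apply: (hit_uniq (H1 sA)); rewrite ?in_row // in_before ?zA ?xA.
Qed.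

(** Some rook (k, p) lies below [p], and [k] is not above [x]. It is not [s], because the run left
    of [s] already holds (s, x). If [k] were lower than [s], its predecessor [k'] would give a
    forced rook (k, k'), and both [p] and [k'] lie to the left of [k], so that one run would hold
    two rooks. *)
Let xpR : (x, p) \in R.
Proof.
have xW : x \in before (opp f) A p by rewrite in_before xA lt_opp.
have [k] := hit_ex (H4 pA) xW.
rewrite in_before in_col lt_opp => /andP[kA pk] kp.
have [kx|kx] := eqVneq k x; first by rewrite -kx.
have xk : f x < f k.
  apply: inj_lt => //; rewrite leNgt; apply/negP=> /(px kA).
  by rewrite leNgt pk.
have [ks|ks] := eqVneq k s.
  by move: kp; rewrite ks => /(s_left pA gps)/eqP; rewrite (negbTE px').
have sk : f s < f k by apply: inj_lt (sx kA xk).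
have sW : s \in before f A k by rewrite in_before sA.
have [k' k'B k'max] := exists_max f sW.
move: (k'B); rewrite in_before => /andP[k'A k'k].
have sk' := k'max _ sW; have xk' := lt_le_trans fxs sk'.
have kk' : (k, k') \in R.
  apply: (increasing_rook fi pl) => // [z zA k'z|y z yA zA /(le_trans (ltW xk'))].
    rewrite leNgt; apply/negP=> zk.
    by have := k'max z; rewrite in_before zA zk leNgt k'z => /(_ isT).
  exact: incr.
have gpk' : g p < g k' := lt_le_trans gps (g_s k'A sk').
have gk'k : g k' < g k by apply: incr => //; apply: ltW.
suff E : p = k' by rewrite E ltxx in gpk'.
apply: (hit_uniq (H1 kA)); rewrite ?in_row // in_before ?pA ?k'A //=.
exact: lt_trans gk'k.
Qed.

Let xR z : (x, z) \in R -> z = p.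
Proof.
move=> xz; have [_ zA zx] := sub xz.
have [_ _ gxp] := A'x pA'.
have /A'x[_ _ gxz] : z \in A' by rewrite A'E eq_sym zx.
by apply: (hit_uniq (H2 xA)); rewrite ?in_row // in_before ?zA ?pA lt_opp.
Qed.

Let Rx z : (z, x) \in R -> z = s \/ z = l.
Proof.
move=> zx; have [zA _ nzx] := sub zx.
have [xz|zx'] := ltP (f x) (f z); [left|right].
  by apply: (hit_uniq (H4 xA)); rewrite ?in_col // in_before ?zA ?sA lt_opp.
have fzx : f z < f x by apply: inj_lt; rewrite // eq_sym.
by apply: (hit_uniq (H3 xA)); rewrite ?in_col // in_before ?zA ?lA.
Qed.

(** The run left of [l] is [x] alone and disappears, while the runs left of [s] and below [p]
    receive (s, p). All other runs of [A'] keep their rooks. *)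
Lemma side_forward : psi R \in placements f g A' /\ phi (psi R) = R.
Proof.
split.
- rewrite inE; apply/placementP; split.
  + move=> a b; rewrite psiE => /orP[/andP[/eqP-> /eqP->]|/and3P[/sub[]]//].
    by rewrite eq_sym.
  + move=> z zA'; have [zA zx gxz] := A'x zA'.
    have [->|zl] := eqVneq z l.
      by apply: hit_before_empty => t /A'x[tA tx _]; apply: lg.
    have [->|zs] := eqVneq z s.
      apply: (@hit_intro _ _ _ p); first by rewrite in_before pA'.
        by rewrite in_row psiE !eqxx.
      move=> t; rewrite in_before in_row psiE eqxx /= => /andP[/A'x[tA tx _] ts].
      case/orP=> [/eqP//|/and3P[/(s_left tA ts) E]].
      by rewrite E eqxx in tx.
    apply: hit_before_del (H1 zA) => [y yA' _|_]; rewrite !in_row.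
      by rewrite psiE (negbTE zs) zA' yA' !andbT.
    by apply/negP=> /Rx[E|E]; [rewrite E eqxx in zs | rewrite E eqxx in zl].
  + move=> z zA'; have [zA zx gxz] := A'x zA'.
    apply: hit_before_del (H2 zA) => [y yA'|]; rewrite lt_opp; last first.
      by rewrite ltNge (ltW gxz).
    rewrite !in_row psiE zA' yA' !andbT.
    by case: andP => // -[/eqP-> /eqP->]; rewrite ltNge (ltW gps).
  + move=> z zA'; have [zA zx gxz] := A'x zA'.
    apply: hit_before_del (H3 zA) => [y yA' |xz].
      rewrite !in_col psiE zA' yA' !andbT.
      by case: andP => // -[/eqP-> /eqP->]; rewrite ltNge (ltW fps).
    by rewrite in_col; apply/negP=> /xR E; move: xz; rewrite E ltNge (ltW fpx).
  + move=> z zA'; have [zA zx gxz] := A'x zA'.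
    have [->|zp] := eqVneq z p.
      apply: (@hit_intro _ _ _ s); first by rewrite in_before sA' lt_opp.
        by rewrite in_col psiE !eqxx.
      move=> t; rewrite in_before in_col psiE eqxx lt_opp andbT.
      move=> /andP[/A'x[tA tx _] pt] /orP[/eqP//|/and3P[tpR _ _]].
      suff E : t = x by rewrite E eqxx in tx.
      by apply: (hit_uniq (H4 pA)); rewrite ?in_col // in_before ?tA ?xA lt_opp.
    apply: hit_before_del (H4 zA) => [y yA' _|_]; rewrite !in_col.
      by rewrite psiE (negbTE zp) zA' yA' !andbT andbF.
    by apply: contraNN zp => /xR->.
- apply/setP=> -[a b]; rewrite phiE psiE.
  (* The run left of [s] already holds (s, x), so (s, p) is really new and [phi] may remove it. *)
  have nsp : (s, p) \notin R.
    by apply/negP=> /(s_left pA gps)/eqP; rewrite (negbTE px').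
  apply/idP/idP.
    case/or4P=> [/andP[/eqP-> /eqP->]|/andP[/eqP-> /eqP->]|/andP[/eqP-> /eqP->]|] //.
    by case/andP=> /negbTE-> /and3P[].
  move=> abR; have [aA bA ab] := sub abR.
  have [ax|ax] := eqVneq a x.
    by rewrite ax in abR; rewrite (xR abR) eqxx.
  have [bx|bx] := eqVneq b x.
    by rewrite bx in abR; case: (Rx abR) => ->; rewrite eqxx ?orbT.
  rewrite !A'E ax bx aA bA abR !andbF !orbT andbT /=.
  by apply/negP=> /andP[/eqP sa /eqP pb]; move: abR; rewrite sa pb (negbTE nsp).
Qed.

End Forward.

Section Backward.

Variable R : {set T * T}.
Hypothesis pl : placement f g A' R.

Let sub a b : (a, b) \in R -> [/\ a \in A', b \in A' & a != b].
Proof. by case/placementP: pl => + _ _ _ _; apply. Qed.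
Let H1 : {in A', forall z, hit (before g A' z) (row R z)}.
Proof. by case/placementP: pl. Qed.
Let H2 : {in A', forall z, hit (before (opp g) A' z) (row R z)}.
Proof. by case/placementP: pl. Qed.
Let H3 : {in A', forall z, hit (before f A' z) (col R z)}.
Proof. by case/placementP: pl. Qed.
Let H4 : {in A', forall z, hit (before (opp f) A' z) (col R z)}.
Proof. by case/placementP: pl. Qed.

Let Rx z : (((x, z) \in R) = false) * (((z, x) \in R) = false).
Proof. by split; apply/negP=> /sub[]; rewrite !A'E eqxx. Qed.

Let after_p z : z \in A' -> f p < f z -> f s <= f z.
Proof.
case/A'x=> zA zx _ pz; apply: sx => //; apply: inj_lt => //.
by rewrite leNgt; apply/negP=> /(px zA); rewrite leNgt pz.
Qed.

(** In [A'] the point [s] comes right after [p], and [gps] extends the increasing sequence upwards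
    from [s] to [p]. The rook is then forced as before, with [p] in the role of [x]. *)
Let spR : (s, p) \in R.
Proof.
apply: (increasing_rook fi pl) => // y z yA' zA' py yz.
have pz := le_lt_trans py yz.
have [yA yx _] := A'x yA'; have [zA zx _] := A'x zA'.
have [yp|yp] := eqVneq y p.
  by rewrite yp; apply: lt_le_trans gps (g_s zA (after_p zA' pz)).
apply: incr => //; apply: le_trans (ltW fxs) _.
by apply: after_p; rewrite // (inj_lt fi yp).
Qed.

Lemma side_backward : phi R \in placements f g A /\ psi (phi R) = R.
Proof.
have nxs : (x == s) = false by rewrite eq_sym (negbTE sx').
have nsl : (s == l) = false by rewrite eq_sym (negbTE ls).
have nxl : (x == l) = false by rewrite eq_sym (negbTE lx).
have nxp : (x == p) = false by rewrite eq_sym (negbTE px').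
split.
- rewrite inE; apply/placementP; split.
  + move=> a b; rewrite phiE.
    case/or4P=> [/andP[/eqP-> /eqP->]|/andP[/eqP-> /eqP->]|/andP[/eqP-> /eqP->]|].
    * by rewrite eq_sym.
    * by [].
    * by [].
    * by case/andP=> _ /sub[/A'x[-> _ _] /A'x[-> _ _]].
  + move=> z zA; have [->|zx] := eqVneq z x; first exact: hit_before_empty.
    have zA' : z \in A' by rewrite A'E zx.
    have [_ _ gxz] := A'x zA'.
    have [zs|zs] := eqVneq z s.
      rewrite zs in gxz *.
      apply: (@hit_intro _ _ _ x); first by rewrite in_before xA.
        by rewrite in_row phiE !eqxx orbT.
      move=> t; rewrite in_before in_row phiE (negbTE sx') nsl eqxx /=.
      move=> /andP[tA ts] /orP[/eqP//|/andP[tp stR]].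
      have [_ tA' _] := sub stR.
      suff E : t = p by rewrite E eqxx in tp.
      by apply: (hit_uniq (H1 sA')); rewrite ?in_row // in_before ?tA' ?pA'.
    have [zl|zl] := eqVneq z l.
      rewrite zl in gxz *.
      apply: (@hit_intro _ _ _ x); first by rewrite in_before xA.
        by rewrite in_row phiE !eqxx !orbT.
      by move=> t; rewrite in_before => /andP[tA /(g_l tA)].
    (* The other runs that receive [x] were not empty: a run to the left contains [l], and in the
       columns below a run upwards contains [p] and a run downwards contains [s]. *)
    apply: hit_before_add (H1 zA') => [y _ _|_].
      by rewrite !in_row phiE (negbTE zx) (negbTE zs) (negbTE zl).
    split; first by rewrite in_row phiE (negbTE zx) (negbTE zs) (negbTE zl) Rx.
    by exists l => //; apply: inj_lt (lg _ _).
  + move=> z zA; have [->|zx] := eqVneq z x.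
      apply: (@hit_intro _ _ _ p).
      * by rewrite in_before pA lt_opp; case: (A'x pA').
      * by rewrite in_row phiE !eqxx.
      * by move=> t _; rewrite in_row phiE eqxx nxs nxl Rx /= orbF => /eqP.
    have zA' : z \in A' by rewrite A'E zx.
    have [_ _ gxz] := A'x zA'.
    apply: hit_before_add (H2 zA') => [y /A'x[_ yx _]|]; rewrite lt_opp; last first.
      by rewrite ltNge (ltW gxz).
    rewrite !in_row phiE (negbTE zx) (negbTE yx) !andbF /=.
    by case: (@andP (z == s)) => // -[/eqP-> /eqP->]; rewrite ltNge (ltW gps).
  + move=> z zA; have [->|zx] := eqVneq z x.
      apply: (@hit_intro _ _ _ l); first by rewrite in_before lA.
        by rewrite in_col phiE !eqxx !orbT.
      move=> t; rewrite in_before in_col phiE nxp Rx eqxx !andbF !andbT orbF /=.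
      by case/andP=> tA tx /orP[/eqP E|/eqP//]; move: tx; rewrite E ltNge (ltW fxs).
    have zA' : z \in A' by rewrite A'E zx.
    apply: hit_before_add (H3 zA') => [y /A'x[_ yx _]|xz].
      rewrite !in_col phiE (negbTE zx) (negbTE yx) !andbF /=.
      by case: (@andP (y == s)) => // -[/eqP-> /eqP->]; rewrite ltNge (ltW fps).
    split; last by exists p => //; apply: lt_trans xz.
    rewrite in_col phiE eqxx (negbTE zx) Rx !andbF !orbF /=.
    by apply: contraTneq xz => ->; rewrite -leNgt (ltW fpx).
  + move=> z zA; have [->|zx] := eqVneq z x.
      apply: (@hit_intro _ _ _ s); first by rewrite in_before sA lt_opp.
        by rewrite in_col phiE !eqxx !orbT.
      move=> t; rewrite in_before in_col phiE nxp Rx eqxx lt_opp !andbF !andbT orbF /=.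
      by case/andP=> tA tx /orP[/eqP//|/eqP E]; move: tx; rewrite E ltNge (ltW flx).
    have zA' : z \in A' by rewrite A'E zx.
    have [->|zp] := eqVneq z p.
      apply: (@hit_intro _ _ _ x); first by rewrite in_before xA lt_opp.
        by rewrite in_col phiE !eqxx.
      move=> t; rewrite in_before in_col phiE (negbTE px') eqxx lt_opp !andbF !andbT /=.
      move=> /andP[tA pt] /orP[/eqP//|/andP[ts tpR]].
      have [tA' _ _] := sub tpR.
      suff E : t = s by rewrite E eqxx in ts.
      by apply: (hit_uniq (H4 pA')); rewrite ?in_col // in_before ?tA' ?sA' lt_opp.
    apply: hit_before_add (H4 zA') => [y _ _|].
      by rewrite !in_col phiE (negbTE zx) (negbTE zp) !andbF.
    rewrite lt_opp => zx'; split.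
      by rewrite in_col phiE (negbTE zx) (negbTE zp) Rx !andbF.
    by exists s => //; rewrite lt_opp (lt_trans zx').
- apply/setP=> -[a b]; rewrite psiE phiE !A'E.
  have [->|ax] := eqVneq a x; first by rewrite nxs !andbF Rx.
  have [->|bx] := eqVneq b x; first by rewrite nxp !andbF Rx.
  rewrite !andbF /=; case: (@andP (a == s)) => [[/eqP-> /eqP->]|_] /=.
    by rewrite spR.
  apply/andP/idP=> [[]//|abR]; split=> //.
  by have [/A'x[-> _ _] /A'x[-> _ _] _] := sub abR.
Qed.

End Backward.

Lemma card_placements_side : #|placements f g A| = #|placements f g (A :\ x)|.
Proof.
apply: (card_eq_cancel_in (h := psi) (k := phi)) => R; rewrite inE.
  exact: side_forward.
exact: side_backward.
Qed.

End SideDeletion.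

(** * The pattern 2413 *)

Section FourPoints.

Variable T : finType.
Implicit Types (f g h : T -> int) (A B : {set T}) (R : {set T * T}).

(** On an explicit list of points this computes to a Boolean condition on finitely many
    memberships. *)
Definition hit_seq h (l : seq T) z (S : {set T}) :=
  ~~ has (fun y => h y < h z) l ||
  (count (fun y => (h y < h z) && (y \in S)) l == 1%N).

Lemma hit_before_seq h A (l : seq T) z (S : {set T}) : uniq l -> A =i l ->
  hit (before h A z) S = hit_seq h l z S.
Proof.
move=> ul Al; congr (_ || _).
  apply/eqP/hasPn=> [/setP W0 y|H].
    by rewrite -Al => yA; move: (W0 y); rewrite !inE yA => /= ->.
  by apply/setP=> y; rewrite !inE Al; apply/negP=> /andP[/H/negP].
rewrite -size_filter -(card_uniqP (filter_uniq _ ul)); congr (_ == _).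
apply: eq_card => y; rewrite mem_filter !inE Al -andbA andbC -andbA.
by congr (_ && _); rewrite andbC.
Qed.

Lemma placement_seq f g A (l : seq T) R : uniq l -> A =i l ->
  placement f g A R =
  [forall s in R, [&& s.1 \in l, s.2 \in l & s.1 != s.2]] &&
  all (fun x => [&& hit_seq g l x (row R x), hit_seq (opp g) l x (row R x),
        hit_seq f l x (col R x) & hit_seq (opp f) l x (col R x)]) l.
Proof.
move=> ul Al; congr (_ && _).
  by apply: eq_forallb => s; rewrite !Al.
apply/forall_inP/allP => H x; move: (H x); rewrite Al => {}H /H;
  by rewrite !(hit_before_seq _ _ _ ul Al).
Qed.

Lemma card_placements_four f g A a e d x :
    A =i [:: a; e; x; d] -> f a < f e -> f e < f x -> f x < f d ->
    g x < g a -> g a < g d -> g d < g e ->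
  #|placements f g A| = 2%N.
Proof.
move=> Al fae fex fxd gxa gad gde.
have fax := lt_trans fae fex; have fed := lt_trans fex fxd.
have fad := lt_trans fax fxd.
have gxd := lt_trans gxa gad; have gae := lt_trans gad gde.
have gxe := lt_trans gxd gde.
have F (h : T -> int) y z : h y < h z ->
  ((h y < h z) = true) * ((h z < h y) = false) *
    ((y == z) = false) * ((z == y) = false).
  move=> yz; rewrite yz [h z < h y]ltNge (ltW yz) [z == y]eq_sym.
  by case: eqVneq yz => // ->; rewrite ltxx.
(* [cmp] decides every comparison and equality between the four points. *)
have cmp := (F f _ _ fae, F f _ _ fex, F f _ _ fxd, F f _ _ fax, F f _ _ fed,
  F f _ _ fad, F g _ _ gxa, F g _ _ gad, F g _ _ gde, F g _ _ gxd,
  F g _ _ gae, F g _ _ gxe, @ltxx, @eqxx).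
have ul : uniq [:: a; e; x; d] by rewrite /= !inE !cmp.
(* [R0] lists the rooks forced by the four runs of a single square; they leave exactly two
   completions. *)
pose R0 := [:: (a, x); (a, e); (d, x); (d, e)].
pose R1 := [set s in [:: (e, a), (x, d) & R0]].
pose R2 := [set s in [:: (e, d), (x, a) & R0]].
have R12 : R1 != R2.
  by apply/eqP=> /setP/(_ (e, a)); rewrite !inE !xpair_eqE !cmp.
suff -> : placements f g A = [set R1; R2] by rewrite cards2 R12.
pose l := [:: a; e; x; d].
pose ok (s : T * T) := [&& s.1 \in l, s.2 \in l & s.1 != s.2].
pose agree (R R' : {set T * T}) :=
  all (fun y => all (fun z => ((y, z) \in R) == ((y, z) \in R')) l) l.
have ok1 s : s \in R1 -> ok s.
  by rewrite inE; apply/allP: s; rewrite /ok /= !inE !cmp.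
have ok2 s : s \in R2 -> ok s.
  by rewrite inE; apply/allP: s; rewrite /ok /= !inE !cmp.
apply/setP=> R; rewrite in_set2 in_set (placement_seq f g R ul Al).
apply/andP/orP=> [[/forall_inP sub]|].
  have Rd y : ((y, y) \in R) = false by apply/negP=> /sub; rewrite eqxx !andbF.
  rewrite /hit_seq /= !(in_row, in_col, Rd, lt_opp, cmp) /=.
  (* Both sets contain only squares with coordinates in [l], so agreement on the listed points is
     equality. *)
  have E R' : (forall s, s \in R' -> ok s) -> agree R R' -> R == R'.
    move=> sub' /allP H; apply/eqP/setP=> -[y z].
    have [yl|yl] := boolP (y \in l); last first.
      by apply/idP/idP=> [/sub|/sub']; rewrite /ok /= (negbTE yl).
    have [zl|zl] := boolP (z \in l); last first.
      by apply/idP/idP=> [/sub|/sub']; rewrite /ok /= (negbTE zl) andbF.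
    by move/allP: (H y yl) => /(_ z zl) /eqP.
  move=> H; suff [|] : agree R R1 \/ agree R R2.
  - by move/(E _ ok1); left.
  - by move/(E _ ok2); right.
  move: H; rewrite /agree /= !Rd !inE !xpair_eqE !cmp /=.
  (* The twelve possible squares are tried with the forced ones first, so that most branches close
     at once. *)
  case: ((a, x) \in R) => //=;
  case: ((d, x) \in R) => //=;
  case: ((a, e) \in R) => //=;
  case: ((d, e) \in R) => //=;
  case: ((a, d) \in R) => //=;
  case: ((e, x) \in R) => //=;
  case: ((x, e) \in R) => //=;
  case: ((d, a) \in R) => //=;
  case: ((e, a) \in R) => //=;
  case: ((e, d) \in R) => //=;
  case: ((x, a) \in R) => //=;
  case: ((x, d) \in R) => //=; by [left | right].
case=> /eqP->; split; try exact/forall_inP;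
  by rewrite /hit_seq /= !(in_row, in_col, lt_opp) !inE !xpair_eqE !cmp /=.
Qed.

End FourPoints.

(** * Skew-merged sets, pinwheels and the induction on the number of points *)

Section SkewMerged.

Variable T : finType.
Implicit Types (f g h : T -> int) (A B : {set T}).

(** [B] ranges over all sets of points rather than subsets of [A], so the same [B] serves after
    deletions. *)
Definition skew f g A B : Prop :=
  {in A &, forall y z, y \in B -> z \in B -> f y < f z -> g y < g z} /\
  {in A &, forall y z, y \notin B -> z \notin B -> f y < f z -> g z < g y}.

Lemma lt_of_contra h y z : injective h -> y != z -> (h z < h y -> False) -> h y < h z.
Proof.
move=> hi yz H; apply: inj_lt; rewrite // 1?eq_sym //.
by rewrite leNgt; apply/negP.
Qed.

Lemma neq_of_lt h y z : h y < h z -> y != z.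
Proof. by apply: contraTneq => ->; rewrite ltxx. Qed.

(** A quarter turn exchanges increasing and decreasing pairs, whence the complement of [B]. *)
Lemma skew_rot f g A B : injective f -> skew f g A B -> skew (opp g) f A (~: B).
Proof.
move=> fi [inc dec]; split=> y z yA zA; rewrite !inE ?negbK => yB zB;
  rewrite lt_opp => zy; have yz := neq_of_lt zy.
- apply: lt_of_contra => [//||zy']; first by rewrite eq_sym.
  by move: (dec _ _ zA yA zB yB zy'); rewrite ltNge (ltW zy).
- apply: lt_of_contra => // yz'.
  by move: (inc _ _ yA zA yB zB yz'); rewrite ltNge (ltW zy).
Qed.

Lemma skew_mirror f g A B : skew f g A B -> skew f (opp g) A (~: B).
Proof.
move=> [inc dec]; split=> y z yA zA; rewrite !inE ?negbK => yB zB yz; rewrite lt_opp.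
  exact: dec.
exact: inc.
Qed.

(** Around the four sides the extreme points alternate between the two classes. This excludes black
    corners and is preserved by a quarter turn. *)
Record pinwheel f g A B (a e d x : T) : Prop := Pinwheel {
  pw_finj : injective f;
  pw_ginj : injective g;
  pw_skew : skew f g A B;
  pw_a : a \in A; pw_aB : a \in B; pw_top : {in A, forall z, f a <= f z};
  pw_e : e \in A; pw_eB : e \notin B; pw_right : {in A, forall z, g z <= g e};
  pw_d : d \in A; pw_dB : d \in B; pw_bottom : {in A, forall z, f z <= f d};
  pw_x : x \in A; pw_xB : x \notin B; pw_left : {in A, forall z, g x <= g z}
}.

Lemma le_opp h y z : (opp h y <= opp h z) = (h z <= h y).
Proof. exact: lerN2. Qed.

Lemma pinwheel_rot f g A B a e d x :
  pinwheel f g A B a e d x -> pinwheel (opp g) f A (~: B) e d x a.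
Proof.
case=> fi gi sk aA aB ta eA eB re dA dB bd xA xB lx.
split=> //; rewrite ?inE ?negbK //.
- exact: opp_inj.
- exact: skew_rot.
- by move=> z zA; rewrite le_opp re.
- by move=> z zA; rewrite le_opp lx.
Qed.

(** A decreasing point below [x] would lie to its left, so all points below [x] are increasing. If
    the neighbours [p] and [s] of [x] are in increasing order, [x] can be deleted; the second
    alternative records what their inversion implies. *)
Lemma pinwheel_left_step f g A B a e d x : pinwheel f g A B a e d x ->
  (exists2 y, y \in A & #|placements f g A| = #|placements f g (A :\ y)|) \/
  {in A, forall z, z != x -> g a <= g z} /\
  exists p s, [/\ p \in A, s \in A, {in A, forall z, f z < f x -> f z <= f p},
                  f x < f s & g s < g p].
Proof.
case=> fi gi [inc dec] aA aB ta eA eB re dA dB bd xA xB lx.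
have BxN y z : y \in B -> z \notin B -> y != z by move=> yB; apply: contraNneq => <-.
have ax := BxN _ _ aB xB; have dx := BxN _ _ dB xB.
have fax : f a < f x by apply: inj_lt (ta _ xA); rewrite // eq_sym.
have fxd : f x < f d by apply: inj_lt (bd _ xA).
have dW : d \in before (opp f) A x by rewrite in_before dA lt_opp.
have [s] := exists_min f dW; rewrite in_before lt_opp => /andP[sA xs] smin.
have aW : a \in before f A x by rewrite in_before aA.
have [p] := exists_max f aW; rewrite in_before => /andP[pA px] pmax.
have aW' : a \in A :\ x by rewrite !inE ax.
have [l] := exists_min g aW'; rewrite !inE => /andP[lx' lA] lmin.
have gx z : z \in A -> z != x -> g x < g z.
  by move=> zA zx; apply: inj_lt (lx _ zA).
have s_succ : {in A, forall z, f x < f z -> f s <= f z}.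
  by move=> z zA xz; apply: smin; rewrite in_before zA lt_opp.
have p_pred : {in A, forall z, f z < f x -> f z <= f p}.
  by move=> z zA zx; apply: pmax; rewrite in_before zA.
have l_second : {in A, forall z, z != x -> g l <= g z}.
  by move=> z zA zx; apply: lmin; rewrite !inE zx.
have belowB z : z \in A -> f x < f z -> z \in B.
  move=> zA xz; apply: contraT => zB.
  by move: (dec _ _ xA zA xB zB xz); rewrite ltNge (lx _ zA).
have incr : {in A &, forall y z, f x <= f y -> f y < f z -> g y < g z}.
  move=> y z yA zA xy yz; have xz := le_lt_trans xy yz.
  have [->|yx] := eqVneq y x; first by apply: gx; rewrite // eq_sym (neq_of_lt xz).
  by apply: inc => //; apply: belowB => //; apply: inj_lt xy.
(* [a] is topmost and increasing, hence leftmost among the increasing points. *)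
have lB : l != a -> l \notin B.
  move=> la; apply/negP=> lB'; have fal : f a < f l by apply: inj_lt (ta _ lA).
  by move: (inc _ _ aA lA aB lB' fal); rewrite ltNge l_second.
have flx : f l < f x.
  have [->//|/lB lB'] := eqVneq l a.
  apply: lt_of_contra => // xl.
  by move: (dec _ _ xA lA xB lB' xl); rewrite ltNge lx.
have sx : s != x by rewrite eq_sym (neq_of_lt xs).
have ps : p != s := neq_of_lt (lt_trans px xs).
have [gps|gsp] := ltP (g p) (g s).
  by left; exists x => //; apply: (card_placements_side (s := s) (p := p) (l := l)).
have {}gsp : g s < g p by apply: inj_lt gsp.
right; split; last by exists p, s.
suff <- : l = a by [].
apply/eqP; apply: contraT => /lB lB'.
(* Since [s] is increasing and inverted with [p], the point [p] is decreasing. A decreasing [l]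
   above [p] lies to the right of [p], hence of [s], and so is not second from the left. *)
have sB := belowB _ sA xs.
have pB : p \notin B.
  apply/negP=> pB; move: (inc _ _ pA sA pB sB (lt_trans px xs)).
  by rewrite ltNge (ltW gsp).
have lp : l != p by apply/eqP=> lp; move: gsp; rewrite -lp ltNge l_second.
have flp : f l < f p by apply: inj_lt (p_pred _ lA flx); rewrite // eq_sym.
by move: (lt_trans gsp (dec _ _ lA pA lB' pB flp)); rewrite ltNge l_second.
Qed.

(** The left step is applied to the four rotations. If no side allows a deletion, the points [a],
    [e], [d], [x] are second from the left, top, right and bottom respectively, which leaves no room
    for a fifth point. *)
Lemma pinwheel_step f g A B a e d x : pinwheel f g A B a e d x ->
  #|placements f g A| = 2%N \/
  exists2 y, y \in A & #|placements f g A| = #|placements f g (A :\ y)|.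
Proof.
move=> pw0; have pw1 := pinwheel_rot pw0.
have pw2 := pinwheel_rot pw1; have pw3 := pinwheel_rot pw2.
have r1 C : #|placements (opp g) f C| = #|placements f g C|.
  exact: card_placements_rot.
have r2 C : #|placements (opp f) (opp g) C| = #|placements f g C|.
  by rewrite -r1; apply: card_placements_rot.
have r3 C : #|placements (opp (opp g)) (opp f) C| = #|placements f g C|.
  by rewrite -r2; apply: card_placements_rot.
have [|[a2 [p [s [pA sA pmax xs sp]]]]] := pinwheel_left_step pw0; first by right.
have [[y yA]|[e2 _]] := pinwheel_left_step pw1.
  by rewrite (r1 A) (r1 (A :\ y)); right; exists y.
have [[y yA]|[d2 _]] := pinwheel_left_step pw2.
  by rewrite (r2 A) (r2 (A :\ y)); right; exists y.
have [[y yA]|[x2 _]] := pinwheel_left_step pw3.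
  by rewrite (r3 A) (r3 (A :\ y)); right; exists y.
left; case: pw0 => fi gi sk aA aB ta eA eB re dA dB bd xA xB lx {pw1 pw2 pw3}.
have BxN y z : y \in B -> z \notin B -> y != z by move=> yB; apply: contraNneq => <-.
have {}e2 z : z \in A -> z != a -> f e <= f z := e2 z.
have {}d2 z : z \in A -> z != e -> g z <= g d.
  by move=> zA ze; have := d2 z zA ze; rewrite le_opp.
have {}x2 z : z \in A -> z != d -> f z <= f x.
  by move=> zA zd; have := x2 z zA zd; rewrite le_opp.
(* Only [d] is below [x], which is second from the bottom; and only [e] is to the right of [d],
   which is second from the right. *)
have sd : s = d.
  by apply/eqP; apply: contraT => /(x2 _ sA); rewrite leNgt xs.
have pe : p = e.
  by apply/eqP; apply: contraT => /(d2 _ pA); rewrite leNgt -sd sp.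
rewrite {}sd {}pe in sp xs pmax.
have ea : e != a by rewrite eq_sym BxN.
have xd : x != d by rewrite eq_sym BxN.
have xa : x != a by rewrite eq_sym BxN.
have fae : f a < f e by apply: inj_lt (ta _ eA).
have ex : e != x by apply/eqP=> ex; move: sp; rewrite ex ltNge lx.
have fex : f e < f x by apply: inj_lt (e2 _ xA xa); rewrite // eq_sym.
have ad : a != d := neq_of_lt (lt_trans fae (lt_trans fex xs)).
apply: (card_placements_four (a := a) (e := e) (x := x) (d := d)) => //.
(* A point other than [a], [x], [d] is above [x], hence not below its predecessor [e]; and it is not
   above [e], which is second from the top. *)
- move=> z; apply/idP/idP=> [zA|]; last first.
    by rewrite !inE => /or4P[] /eqP->.
  rewrite !inE; have [//|za] := eqVneq z a.
  have [|zx] := eqVneq z x; first by rewrite !orbT.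
  have [|zd] := eqVneq z d; first by rewrite !orbT.
  have fzx : f z < f x by apply: inj_lt (x2 _ zA zd); rewrite // eq_sym.
  have -> : z = e by apply/fi/eqP; rewrite eq_le (pmax _ zA fzx) (e2 _ zA za).
  by rewrite eqxx ?orbT.
- by apply: inj_lt (lx _ aA); rewrite // eq_sym.
- by apply: inj_lt (a2 _ dA _); rewrite // eq_sym.
Qed.

Lemma corner_step f g A x :
    injective f -> injective g -> x \in A ->
    {in A, forall z, f x <= f z} -> {in A, forall z, g x <= g z} ->
  #|placements f g A| = 1%N \/
  exists2 y, y \in A & #|placements f g A| = #|placements f g (A :\ y)|.
Proof.
move=> fi gi xA xf xg; have [A0|An0] := eqVneq (A :\ x) set0.
  by left; rewrite -(setD1K xA) A0 setU0 placements1.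
by right; exists x => //; apply: card_placements_corner.
Qed.

Lemma card_placements_opp_col f g A :
  #|placements f (opp g) A| = #|placements f g A|.
Proof. by rewrite (card_placements_swap (opp g) f) (card_placements_rot f g). Qed.

(** If the leftmost point is increasing, it is the topmost one. Otherwise, if the bottommost point
    is decreasing, it is the leftmost one. Otherwise, if the rightmost point is increasing, it is
    the bottommost one. Each case gives a black corner, and what remains is a pinwheel. *)
Lemma skew_step_increasing f g A B a :
    injective f -> injective g -> skew f g A B ->
    a \in A -> a \in B -> {in A, forall z, f a <= f z} ->
  [\/ #|placements f g A| = 1%N, #|placements f g A| = 2%N |
      exists2 y, y \in A & #|placements f g A| = #|placements f g (A :\ y)|].
Proof.
move=> fi gi sk aA aB ta; have [inc dec] := sk.
have [d dA bd] := exists_max f aA.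
have [x xA lx] := exists_min g aA.
have [e eA re] := exists_max g aA.
have oi := opp_inj.
have r2 C : #|placements (opp f) (opp g) C| = #|placements f g C|.
  by rewrite (card_placements_opp_row f (opp g)) (card_placements_opp_col f g).
have [xB|xB] := boolP (x \in B).
  have xa : x = a.
    apply/eqP; apply: contraT => xa; have fax : f a < f x by apply: inj_lt (ta _ xA).
    by move: (inc _ _ aA xA aB xB fax); rewrite ltNge lx.
  rewrite xa in lx; have [|] := corner_step fi gi aA ta lx.
    by constructor 1.
  by constructor 3.
have [dB|dB] := boolP (d \in B); last first.
  have xd : x = d.
    apply/eqP; apply: contraT => xd.
    have fxd : f x < f d by apply: inj_lt (bd _ xA); rewrite // eq_sym.
    by move: (dec _ _ xA dA xB dB fxd); rewrite ltNge lx.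
  have xb : {in A, forall z, opp f x <= opp f z}.
    by move=> z zA; rewrite le_opp xd bd.
  have [|] := corner_step (oi _ _ fi) gi xA xb lx.
  - by rewrite (card_placements_opp_row f g); constructor 1.
  - by case=> y yA; rewrite !(card_placements_opp_row f g); constructor 3; exists y.
have [eB|eB] := boolP (e \in B).
  have ed : e = d.
    apply/eqP; apply: contraT => ed.
    have fed : f e < f d by apply: inj_lt (bd _ eA); rewrite // eq_sym.
    by move: (inc _ _ eA dA eB dB fed); rewrite ltNge re.
  have eb : {in A, forall z, opp f e <= opp f z}.
    by move=> z zA; rewrite le_opp ed bd.
  have er : {in A, forall z, opp g e <= opp g z}.
    by move=> z zA; rewrite le_opp re.
  have [|] := corner_step (oi _ _ fi) (oi _ _ gi) eA eb er.
  - by rewrite r2; constructor 1.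
  - by case=> y yA; rewrite !r2; constructor 3; exists y.
have pw : pinwheel f g A B a e d x by [].
by have [|] := pinwheel_step pw; [constructor 2 | constructor 3].
Qed.

Lemma skew_step f g A B a :
    injective f -> injective g -> skew f g A B -> a \in A ->
  [\/ #|placements f g A| = 1%N, #|placements f g A| = 2%N |
      exists2 y, y \in A & #|placements f g A| = #|placements f g (A :\ y)|].
Proof.
move=> fi gi sk aA; have [t tA tmin] := exists_min f aA.
have [tB|tB] := boolP (t \in B); first exact: skew_step_increasing sk tA tB tmin.
have tB' : t \in ~: B by rewrite inE.
(* A left-right reflection turns a decreasing topmost point into an increasing one. *)
have := skew_step_increasing fi (opp_inj gi) (skew_mirror sk) tA tB' tmin.
rewrite !(card_placements_opp_col f g) => -[|| [y yA]].
- by constructor 1.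
- by constructor 2.
- by rewrite (card_placements_opp_col f g); constructor 3; exists y.
Qed.

Lemma card_placements_skew f g A B :
    injective f -> injective g -> skew f g A B ->
  #|placements f g A| = 1%N \/ #|placements f g A| = 2%N.
Proof.
move=> fi gi; have [m] := ubnP #|A|; elim: m A => // m IH A cA sk.
have [->|/set0Pn[a aA]] := eqVneq A set0; first by left; rewrite placements0.
have [||[y yA ->]] := skew_step fi gi sk aA; [by left | by right | apply: IH].
  by rewrite (cardsD1 y A) yA in cA.
have [inc dec] := sk.
by split=> u v /setD1P[_ uA] /setD1P[_ vA]; [apply: inc | apply: dec].
Qed.

End SkewMerged.

(** * The words of the grid, and the passage from squares to points *)

Section Words.

Variable n : nat.
Implicit Types (w : 'S_n) (W R : {set square n}).

Definition left_word w i : {set square n} :=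
  [set s : square n | (s.1 == i) && (s.2 < w i)%N].
Definition right_word w i : {set square n} :=
  [set s : square n | (s.1 == i) && (w i < s.2)%N].

Lemma left_run w i s : s \in left_word w i ->
  row_run (left_word w i) && (left_word w i \subset white w).
Proof.
rewrite inE => /andP[_ s2]; apply/andP; split.
  have lt0 : (0 < n)%N by apply: leq_ltn_trans (ltn_ord (w i)).
  (* The run ends just before the black square. The square [s] shows that [w i] is positive, so the
     predecessor is not truncated. *)
  have ltp : ((w i).-1 < n)%N by apply: leq_ltn_trans (leq_pred _) (ltn_ord _).
  apply/existsP; exists i; apply/existsP; exists (Ordinal lt0).
  apply/existsP; exists (Ordinal ltp); rewrite leq0n /=.
  apply/eqP/setP=> t; rewrite !inE /=; congr (_ && _).
  by case: (val (w i)) s2.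
apply/subsetP=> t; rewrite !inE => /andP[/eqP->].
by apply: contraTneq => ->; rewrite ltnn.
Qed.

Lemma right_run w i s : s \in right_word w i ->
  row_run (right_word w i) && (right_word w i \subset white w).
Proof.
rewrite inE => /andP[_ s2]; apply/andP; split.
  have ltS : ((w i).+1 < n)%N by apply: leq_ltn_trans (ltn_ord s.2).
  have n0 : (0 < n)%N by apply: leq_ltn_trans (ltn_ord (w i)).
  have ltp : (n.-1 < n)%N by rewrite prednK.
  apply/existsP; exists i; apply/existsP; exists (Ordinal ltS).
  apply/existsP; exists (Ordinal ltp); apply/andP; split=> /=.
    by rewrite -ltnS prednK.
  apply/eqP/setP=> t; rewrite !inE /=; congr (_ && _).
  by rewrite -[X in _ = _ && X]ltnS prednK // ltn_ord andbT.
apply/subsetP=> t; rewrite !inE => /andP[/eqP->].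
by apply: contraTneq => ->; rewrite ltnn.
Qed.

Lemma run_sub_word w W s : row_run W -> W \subset white w -> s \in W ->
  W \subset left_word w s.1 \/ W \subset right_word w s.1.
Proof.
case/existsP=> i /existsP[a /existsP[b /andP[_ /eqP->]]] /subsetP wW.
rewrite inE => /andP[/eqP-> /andP[as_ sb]].
have : ~~ (a <= w i <= b)%N.
  by apply/negP=> H; have := wW (i, w i); rewrite !inE /= eqxx H eqxx => /(_ isT).
rewrite negb_and -!ltnNge => /orP[wa|bw]; [right|left];
  apply/subsetP=> t; rewrite !inE => /and3P[-> at_ tb] /=.
  exact: leq_trans wa at_.
exact: leq_ltn_trans tb bw.
Qed.

(** A white run cannot pass the black square of its row, so it lies in the left or the right part of
    that row; these parts, when nonempty, are themselves runs. *)
Lemma across_wordP w W :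
  reflect (W != set0 /\ exists i, W = left_word w i \/ W = right_word w i)
          (across_word w W).
Proof.
rewrite /across_word; apply: (iffP maxsetP) => [[/andP[Wrun Ww] Wmax]|].
  have [s sW] : exists s, s \in W.
    case/existsP: Wrun => i /existsP[a /existsP[b /andP[ab /eqP->]]].
    by exists (i, a); rewrite inE eqxx leqnn ab.
  split; first by apply/set0Pn; exists s.
  exists s.1; have [WL|WR] := run_sub_word Wrun Ww sW; [left|right].
    by symmetry; exact: Wmax (left_run (subsetP WL _ sW)) WL.
  by symmetry; exact: Wmax (right_run (subsetP WR _ sW)) WR.
case=> /set0Pn[s sW] [i WE].
have si : s.1 = i by case: WE sW => ->; rewrite inE => /andP[/eqP].
split; first by case: WE sW => -> ; [apply: left_run | apply: right_run].
move=> B /andP[Brun Bw] WB; apply/eqP; rewrite eqEsubset WB andbT.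
have [] := run_sub_word Brun Bw (subsetP WB _ sW); rewrite si => BW;
  case: WE sW => WE; rewrite WE // => sW.
- have sB : s \in B by rewrite (subsetP WB) // WE.
  move: sW (subsetP BW _ sB); rewrite !inE => /andP[_ +] /andP[_].
  by move=> /ltnW; rewrite leqNgt => /negbTE->.
- have sB : s \in B by rewrite (subsetP WB) // WE.
  move: sW (subsetP BW _ sB); rewrite !inE => /andP[_ +] /andP[_].
  by move=> /ltnW; rewrite leqNgt => /negbTE->.
Qed.

Lemma across_hit w R :
  [forall W, across_word w W ==> (#|R :&: W| == 1%N)] =
  [forall i, hit (left_word w i) R && hit (right_word w i) R].
Proof.
apply/forall_inP/forallP=> [H i|H W /across_wordP[W0 [i WE]]].
  rewrite /hit ![_ :&: R]setIC; apply/andP; split; rewrite -implyNb;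
    by apply/implyP=> W0; apply: H; apply/across_wordP; split=> //; exists i; auto.
have /andP[] := H i; rewrite /hit ![_ :&: R]setIC.
by case: WE W0 => -> /negbTE-> /=.
Qed.

Lemma column_run_tr W : column_run W = row_run (tr W).
Proof.
apply: eq_existsb => j; apply: eq_existsb => a; apply: eq_existsb => b.
congr (_ && _); apply/eqP/eqP=> [->|E]; first by apply/setP=> s; rewrite !inE.
by rewrite -[W]trK E; apply/setP=> s; rewrite !inE.
Qed.

Lemma tr_subset W R : (tr W \subset R) = (W \subset tr R).
Proof.
apply/subsetP/subsetP=> H [i j] ijW.
  by rewrite inE /=; apply: H; rewrite inE.
by have := H (j, i); rewrite !inE /= in ijW *; apply.
Qed.

Lemma white_tr w : tr (white w) = white w^-1%g.
Proof.
apply/setP=> -[i j]; rewrite !inE /= -(inj_eq (@perm_inj _ w^-1%g)) permK.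
by rewrite eq_sym.
Qed.

(** Transposing the grid of [w] gives the grid of its inverse, so down words need no separate
    analysis. *)
Lemma down_word_tr w W : down_word w W = across_word w^-1%g (tr W).
Proof.
have runE B : (column_run B && (B \subset white w)) =
    (row_run (tr B) && (tr B \subset white w^-1%g)).
  by rewrite column_run_tr -white_tr tr_subset trK.
apply/maxsetP/maxsetP=> -[WP Wm].
  split=> [|B BP WB]; first by rewrite -runE.
  have E : tr B = W by apply: Wm; [rewrite runE (trK B) | rewrite -tr_subset].
  by rewrite -E (trK B).
split=> [|B BP WB]; first by rewrite runE.
have E : tr B = tr W by apply: Wm; [rewrite -runE | rewrite tr_subset (trK B)].
by rewrite -[B]trK E (trK W).
Qed.

Lemma card_tr W : #|tr W| = #|W|.
Proof.
have -> : tr W = (fun s => (s.2, s.1)) @^-1: W by apply/setP=> s; rewrite !inE.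
rewrite card_preimset //; by move=> [i j] [k l] [-> ->].
Qed.

Lemma down_hit w R :
  [forall W, down_word w W ==> (#|R :&: W| == 1%N)] =
  [forall i, hit (left_word w^-1%g i) (tr R) && hit (right_word w^-1%g i) (tr R)].
Proof.
rewrite -across_hit; apply/forall_inP/forall_inP=> H W.
  have trI : tr R :&: W = tr (R :&: tr W) by apply/setP=> -[i j]; rewrite !inE.
  by move=> WP; rewrite trI card_tr H // down_word_tr trK.
have trI : tr R :&: tr W = tr (R :&: W) by apply/setP=> -[i j]; rewrite !inE.
by rewrite down_word_tr => /H; rewrite trI card_tr.
Qed.

Lemma hit_imset (U V : finType) (h : U -> V) (W : {set U}) (S : {set V}) :
  injective h -> hit (h @: W) S = hit W (h @^-1: S).
Proof.
move=> hi; rewrite /hit imset_eq0; congr (_ || (_ == _)).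
rewrite -[RHS](card_imset _ hi); congr #|pred_of_set _|.
apply/setP=> v; rewrite inE; apply/andP/imsetP.
  by move=> [/imsetP[u uW ->] huS]; exists u; rewrite // !inE uW.
by move=> [u]; rewrite !inE => /andP[uW huS] ->; rewrite imset_f.
Qed.

Definition row_of (i : 'I_n) : int := i%:Z.
Definition col_of w (i : 'I_n) : int := (w i)%:Z.

(* Column [j] is named by the row [w^-1 j] of its black square. *)
Definition on_points w R : {set square n} := [set s | (s.1, w s.2) \in R].

(** Each of the four runs at a black square is the image of a [before] set under an injective
    renaming, and [hit] is invariant under such a renaming. *)
Lemma rook_placementE w R :
  complete_rook_placement w R =
  placement row_of (col_of w) [set: 'I_n] (on_points w R).
Proof.
have hl i : hit (left_word w i) R =
    hit (before (col_of w) setT i) (row (on_points w R) i).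
  have -> : left_word w i = (fun k => (i, w k)) @: before (col_of w) setT i.
    apply/setP=> -[i' j]; rewrite inE /=; apply/andP/imsetP=> [[/eqP-> ji]|].
      by exists (w^-1 j)%g; rewrite ?permKV // !inE /col_of permKV ltz_nat.
    by move=> [k]; rewrite !inE ltz_nat => ki [-> ->].
  by rewrite hit_imset => [|k k' [] /perm_inj//]; congr (hit _ _);
    apply/setP=> k; rewrite !inE.
have hr i : hit (right_word w i) R =
    hit (before (opp (col_of w)) setT i) (row (on_points w R) i).
  have -> : right_word w i = (fun k => (i, w k)) @: before (opp (col_of w)) setT i.
    apply/setP=> -[i' j]; rewrite inE /=; apply/andP/imsetP=> [[/eqP-> ji]|].
      by exists (w^-1 j)%g; rewrite ?permKV // !inE lt_opp /col_of permKV ltz_nat.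
    by move=> [k]; rewrite !inE lt_opp ltz_nat => ki [-> ->].
  by rewrite hit_imset => [|k k' [] /perm_inj//]; congr (hit _ _);
    apply/setP=> k; rewrite !inE.
have ht k : hit (left_word w^-1%g (w k)) (tr R) =
    hit (before row_of setT k) (col (on_points w R) k).
  have -> : left_word w^-1%g (w k) = (fun i => (w k, i)) @: before row_of setT k.
    apply/setP=> -[j i]; rewrite inE /= permK; apply/andP/imsetP=> [[/eqP-> ik]|].
      by exists i; rewrite // !inE ltz_nat.
    by move=> [i']; rewrite !inE ltz_nat => ? [-> ->].
  by rewrite hit_imset => [|i i' []//]; congr (hit _ _);
    apply/setP=> i; rewrite !inE.
have hb k : hit (right_word w^-1%g (w k)) (tr R) =
    hit (before (opp row_of) setT k) (col (on_points w R) k).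
  have -> : right_word w^-1%g (w k) = (fun i => (w k, i)) @: before (opp row_of) setT k.
    apply/setP=> -[j i]; rewrite inE /= permK; apply/andP/imsetP=> [[/eqP-> ik]|].
      by exists i; rewrite // !inE lt_opp ltz_nat.
    by move=> [i']; rewrite !inE lt_opp ltz_nat => ? [-> ->].
  by rewrite hit_imset => [|i i' []//]; congr (hit _ _);
    apply/setP=> i; rewrite !inE.
have -> : complete_rook_placement w R = [&& R \subset white w,
    [forall i, hit (left_word w i) R && hit (right_word w i) R] &
    [forall i, hit (left_word w^-1%g i) (tr R) && hit (right_word w^-1%g i) (tr R)]].
  by congr [&& _, _ & _]; [exact: across_hit | exact: down_hit].
apply/and3P/placementP=> [[/subsetP Rw /forallP Hr /forallP Hc]|[sub H1 H2 H3 H4]].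
  split=> [i k|i _|i _|k _|k _].
  - rewrite inE /= => /Rw; rewrite !inE (inj_eq perm_inj) eq_sym; by split.
  - by rewrite -hl; case/andP: (Hr i).
  - by rewrite -hr; case/andP: (Hr i).
  - by rewrite -ht; case/andP: (Hc (w k)).
  - by rewrite -hb; case/andP: (Hc (w k)).
split.
- apply/subsetP=> -[i j] ijR; rewrite inE /=.
  have [] := sub i (w^-1 j)%g; first by rewrite inE /= permKV.
  by move=> _ _; apply: contraNneq => ->; rewrite permK.
- by apply/forallP=> i; rewrite hl hr H1 ?H2.
(* Every column is written as [w k], the form in which [ht] and [hb] describe its runs. *)
- apply/forallP=> j; rewrite -(permKV w j) ht hb H3 ?H4 //.
Qed.

Lemma card_rook_placements w :
  #|[set R | complete_rook_placement w R]| =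
  #|placements row_of (col_of w) [set: 'I_n]|.
Proof.
pose k R : {set square n} := [set s | (s.1, (w^-1 s.2)%g) \in R].
have kK R : on_points w (k R) = R.
  by apply/setP=> -[i j]; rewrite !inE /= permK.
apply: (card_eq_cancel_in (h := on_points w) (k := k)) => R; rewrite !inE.
  rewrite rook_placementE; split=> //.
  by apply/setP=> -[i j]; rewrite !inE /= permKV.
by rewrite rook_placementE kK.
Qed.

End Words.

Local Close Scope ring_scope.

Theorem proposition3p8 (n : nat) (w : 'S_n) (hw : skew_merged w) :
  #|[set R | complete_rook_placement w R]| = 1 \/
  #|[set R | complete_rook_placement w R]| = 2.
Proof.
rewrite card_rook_placements; have [B [inc dec]] := hw.
apply: (card_placements_skew (B := B)).
- by move=> i j [/val_inj].
- by move=> i j [/val_inj/perm_inj].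
split=> i j _ _ iB jB; rewrite !ltz_nat; first exact: inc.
by apply: dec; rewrite inE.
Qed.
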